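(* Let $0<l_2\le l_1$ be real numbers, and put $h_a^{**}=l_1l_2/\sqrt{l_1^2+l_2^2}$. For a real number $x$ consider the triangles $ABC$ with $l_a=l_2$, $l_b=l_1$ and $h_a=x$. If $h_a^{**}<x<l_2$, there exist exactly two such triangles. If $0<x\le h_a^{**}$ or $x=l_2$, there exists a unique such triangle. For all other values of $x$ no such triangle exists.
   Context: For a non-degenerate triangle $ABC$ in the Euclidean plane, $l_a$ and $l_b$ denote the lengths of the internal angle bisectors drawn from $A$ and $B$ respectively, measured from the vertex to the opposite side; $h_a$ is the length of the height (altitude) from $A$ onto the line $BC$. Triangles are counted up to congruence respecting the vertex labels. *)

(* Defs.v *)
From Stdlib Require Export Reals.

Open Scope R_scope.

Definition point : Type := (R * R)%type.

Definition edist (P Q : point) : R :=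
  dist_euc (fst P) (snd P) (fst Q) (snd Q).

(* Inner product of the vectors OP and OQ. *)
Definition dot (O P Q : point) : R :=
  (fst P - fst O) * (fst Q - fst O) + (snd P - snd O) * (snd Q - snd O).

(* Unoriented angle POQ in [0, PI]; meaningful only if P and Q differ from O. *)
Definition angle (P O Q : point) : R :=
  acos (dot O P Q / (edist O P * edist O Q)).

(* The point P + t (Q - P). *)
Definition affine_pt (P Q : point) (t : R) : point :=
  (fst P + t * (fst Q - fst P), snd P + t * (snd Q - snd P)).

Definition on_line (P Q X : point) : Prop :=
  exists t : R, X = affine_pt P Q t.

Definition on_segment (P Q X : point) : Prop :=
  exists t : R, 0 <= t <= 1 /\ X = affine_pt P Q t.

Definition collinear (P Q S : point) : Prop :=
  exists a b c : R, (a <> 0 \/ b <> 0) /\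
    a * fst P + b * snd P = c /\
    a * fst Q + b * snd Q = c /\
    a * fst S + b * snd S = c.

Record triangle : Type := Triangle {
  vA : point;
  vB : point;
  vC : point;
  nondegenerate : ~ collinear vA vB vC
}.

(* The internal bisector from P in the triangle PQS, cut off at its
   intersection D with the side QS, has length l. For a non-degenerate
   triangle D exists and is unique. *)
Definition bisector_length (P Q S : point) (l : R) : Prop :=
  exists D : point,
    on_segment Q S D /\ angle Q P D = angle D P S /\ edist P D = l.

(* The altitude from P onto the line QS, with foot H, has length h. *)
Definition height_length (P Q S : point) (h : R) : Prop :=
  exists H : point,
    on_line Q S H /\ dot H P Q = 0 /\ dot H P S = 0 /\ edist P H = h.

Definition l_a (T : triangle) (l : R) : Prop :=
  bisector_length (vA T) (vB T) (vC T) l.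

Definition l_b (T : triangle) (l : R) : Prop :=
  bisector_length (vB T) (vC T) (vA T) l.

Definition h_a (T : triangle) (h : R) : Prop :=
  height_length (vA T) (vB T) (vC T) h.

Definition isometry (f : point -> point) : Prop :=
  forall P Q : point, edist (f P) (f Q) = edist P Q.

(* Reflections are allowed; the vertex labels are respected. *)
Definition congruent (T U : triangle) : Prop :=
  exists f : point -> point,
    isometry f /\ f (vA T) = vA U /\ f (vB T) = vB U /\ f (vC T) = vC U.

Definition exactly_two (P : triangle -> Prop) : Prop :=
  exists T1 T2 : triangle,
    P T1 /\ P T2 /\ ~ congruent T1 T2 /\
    forall T : triangle, P T -> congruent T T1 \/ congruent T T2.

Definition exactly_one (P : triangle -> Prop) : Prop :=
  exists T1 : triangle, P T1 /\ forall T : triangle, P T -> congruent T T1.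

Definition none (P : triangle -> Prop) : Prop :=
  forall T : triangle, ~ P T.

Definition has_data (l1 l2 x : R) (T : triangle) : Prop :=
  l_a T l2 /\ l_b T l1 /\ h_a T x.

Definition h_a_starstar (l1 l2 : R) : R := l1 * l2 / sqrt (l1 ^ 2 + l2 ^ 2).

(* Main.v *)
(* Let w and d be half the sum and half the difference of the angles at B and C.
   Then h_a = l_a cos d, so d is determined up to sign by cos d = x / l_2, and the
   sign of d separates the two possible congruence classes. With l_a and h_a fixed,
   the condition on l_b becomes
     2 cos b (x / l_1 - sin b) = (sin w ^ 2 - sin d ^ 2) / sin (2 w),  b = (w + d) / 2,
   on |d| < w < pi / 2. Wherever the left side is positive it decreases in w while the
   right side increases, so each d gives at most one triangle; comparing both sides at
   w = |d| shows that there is one iff sin d < x / l_1. This always holds for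
   d <= 0, and for d > 0 it is equivalent to x > h_a^**. *)

Require Import Defs.
From Stdlib Require Import Reals Lra Psatz.
Open Scope R_scope.

(** * Coordinate identities in the plane *)

(** Twice the signed area of the triangle PQS. *)
Definition cross (P Q S : point) : R :=
  (fst Q - fst P) * (snd S - snd P) - (snd Q - snd P) * (fst S - fst P).

Lemma sqr_eq_nonneg (a b : R) : 0 <= a -> 0 <= b -> a ^ 2 = b ^ 2 -> a = b.
Proof. intros Ha Hb H. apply Rsqr_inj; unfold Rsqr; lra. Qed.

Lemma edist_nonneg (P Q : point) : 0 <= edist P Q.
Proof. apply sqrt_pos. Qed.

Lemma edist_sqr (P Q : point) :
  edist P Q ^ 2 = (fst P - fst Q) ^ 2 + (snd P - snd Q) ^ 2.
Proof.
unfold edist, dist_euc. rewrite pow2_sqrt; [unfold Rsqr; ring |].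
apply Rplus_le_le_0_compat; apply Rle_0_sqr.
Qed.

Lemma edist_eq (P Q : point) (r : R) : 0 <= r ->
  (fst P - fst Q) ^ 2 + (snd P - snd Q) ^ 2 = r ^ 2 -> edist P Q = r.
Proof.
intros Hr H. apply sqr_eq_nonneg; [apply edist_nonneg | exact Hr |].
now rewrite edist_sqr.
Qed.

Lemma edist_sym (P Q : point) : edist P Q = edist Q P.
Proof. apply edist_eq; [apply edist_nonneg |]. rewrite edist_sqr. ring. Qed.

Lemma edist_pos (P Q : point) :
  fst P <> fst Q \/ snd P <> snd Q -> 0 < edist P Q.
Proof.
intros H. unfold edist, dist_euc. apply sqrt_lt_R0.
destruct H as [H|H].
- apply Rplus_lt_le_0_compat; [apply Rsqr_pos_lt; lra | apply Rle_0_sqr].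
- apply Rplus_le_lt_0_compat; [apply Rle_0_sqr | apply Rsqr_pos_lt; lra].
Qed.

(** The law of cosines. *)
Lemma dot_sides (P Q S : point) :
  2 * dot P Q S = edist P Q ^ 2 + edist P S ^ 2 - edist Q S ^ 2.
Proof. rewrite !edist_sqr. unfold dot. ring. Qed.

Lemma lagrange_identity (P Q S : point) :
  dot P Q S ^ 2 + cross P Q S ^ 2 = (edist P Q * edist P S) ^ 2.
Proof. rewrite Rpow_mult_distr, !edist_sqr. unfold dot, cross. ring. Qed.

Lemma cross_cycle (P Q S : point) : cross Q S P = cross P Q S.
Proof. unfold cross. ring. Qed.

Lemma collinear_cross (P Q S : point) : collinear P Q S <-> cross P Q S = 0.
Proof.
unfold collinear, cross. split.
- intros (a & b & c & Hab & HP & HQ & HS).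
  assert (Ha : a * ((fst Q - fst P) * (snd S - snd P)
                    - (snd Q - snd P) * (fst S - fst P)) = 0).
  { replace (a * _) with ((a * (fst Q - fst P)) * (snd S - snd P)
       - (snd Q - snd P) * (a * (fst S - fst P))) by ring.
    replace (a * (fst Q - fst P)) with (- b * (snd Q - snd P)) by lra.
    replace (a * (fst S - fst P)) with (- b * (snd S - snd P)) by lra. ring. }
  assert (Hb : b * ((fst Q - fst P) * (snd S - snd P)
                    - (snd Q - snd P) * (fst S - fst P)) = 0).
  { replace (b * _) with ((fst Q - fst P) * (b * (snd S - snd P))
       - (b * (snd Q - snd P)) * (fst S - fst P)) by ring.
    replace (b * (snd Q - snd P)) with (- a * (fst Q - fst P)) by lra.
    replace (b * (snd S - snd P)) with (- a * (fst S - fst P)) by lra. ring. }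
  destruct Hab as [H|H].
  + destruct (Rmult_integral _ _ Ha); [contradiction | assumption].
  + destruct (Rmult_integral _ _ Hb); [contradiction | assumption].
(* The line is PQ; if P = Q it is PS, or the vertical line through P when S has the same
   abscissa. *)
- intros H.
  destruct (Req_dec (fst Q - fst P) 0) as [H1|H1];
    [destruct (Req_dec (snd Q - snd P) 0) as [H2|H2] |].
  + destruct (Req_dec (fst S - fst P) 0) as [H3|H3].
    * exists 1, 0, (fst P). repeat split; lra.
    * exists (snd S - snd P), (- (fst S - fst P)),
        ((snd S - snd P) * fst P - (fst S - fst P) * snd P).
      repeat split; [right; lra | ring | | ring].
      replace (fst Q) with (fst P) by lra. replace (snd Q) with (snd P) by lra. ring.
  + exists (snd Q - snd P), (- (fst Q - fst P)),
      ((snd Q - snd P) * fst P - (fst Q - fst P) * snd P).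
    repeat split; [left; exact H2 | ring | ring | lra].
  + exists (snd Q - snd P), (- (fst Q - fst P)),
      ((snd Q - snd P) * fst P - (fst Q - fst P) * snd P).
    repeat split; [right; lra | ring | ring | lra].
Qed.

Lemma edist_pos_cross (P Q S : point) : cross P Q S <> 0 -> 0 < edist P Q.
Proof.
intros H. apply edist_pos.
destruct (Req_dec (fst P) (fst Q)) as [H1|H1]; [right | now left].
intros H2. apply H. unfold cross. rewrite H1, H2. ring.
Qed.

(** The Lagrange identity implies Cauchy-Schwarz, so the argument of [acos] in [angle] lies in
    [-1, 1], where [cos] undoes [acos]. *)
Lemma cos_angle (P O Q : point) : 0 < edist O P -> 0 < edist O Q ->
  cos (angle P O Q) * (edist O P * edist O Q) = dot O P Q.
Proof.
intros HP HQ. pose proof (lagrange_identity O P Q) as L.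
pose proof (Rmult_lt_0_compat _ _ HP HQ) as HM.
set (M := edist O P * edist O Q) in *.
unfold angle. fold M. rewrite cos_acos; [field; lra |].
assert (E : dot O P Q / M * M = dot O P Q) by (field; lra).
set (y := dot O P Q / M) in *. rewrite <- E in L.
assert (Hy : y ^ 2 * M ^ 2 <= 1 * M ^ 2) by nra.
apply Rmult_le_reg_r in Hy; [nra |]. apply pow_lt, HM.
Qed.

Lemma angle_eq (P O Q P' O' Q' : point) :
  dot O P Q / (edist O P * edist O Q) = dot O' P' Q' / (edist O' P' * edist O' Q') ->
  angle P O Q = angle P' O' Q'.
Proof. intros H. unfold angle. now rewrite H. Qed.

(** * Bisectors and altitudes in terms of side lengths and area *)

(** The bisector divides QS in the ratio PQ : PS, so its foot has parameter m / (m + n) with m = PQ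
    and n = PS; the length then follows as in Stewart's theorem. *)
Lemma bisector_length_sides (P Q S : point) (l : R) :
  cross P Q S <> 0 -> 0 <= l ->
  bisector_length P Q S l <->
  l ^ 2 * (edist P Q + edist P S) ^ 2 =
  edist P Q * edist P S * ((edist P Q + edist P S) ^ 2 - edist Q S ^ 2).
Proof.
intros Hc Hl.
assert (Hm : 0 < edist P Q) by (apply (edist_pos_cross _ _ S Hc)).
assert (Hn : 0 < edist P S).
{ rewrite edist_sym. apply (edist_pos_cross _ _ Q). now rewrite <- (cross_cycle S P Q). }
pose proof (lagrange_identity P Q S) as L.
assert (Hg : 2 * edist P Q * edist P S * (edist P Q * edist P S + dot P Q S) =
  edist P Q * edist P S * ((edist P Q + edist P S) ^ 2 - edist Q S ^ 2)).
{ replace (edist Q S ^ 2) with (edist P Q ^ 2 + edist P S ^ 2 - 2 * dot P Q S)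
    by (rewrite dot_sides; ring). ring. }
rewrite <- Hg. clear Hg.
(* Equality would make the angle at P zero. *)
assert (Hmn : edist P Q * edist P S <> dot P Q S).
{ intros E. rewrite E in L. apply Hc. nra. }
pose proof (edist_sqr P Q) as Em. pose proof (edist_sqr P S) as En.
set (m := edist P Q) in *. set (n := edist P S) in *. set (g := dot P Q S) in *.
assert (HQ : forall t, dot P Q (affine_pt Q S t) = (1 - t) * m ^ 2 + t * g).
{ intros t. rewrite Em. unfold g, dot, affine_pt. simpl. ring. }
assert (HS : forall t, dot P (affine_pt Q S t) S = (1 - t) * g + t * n ^ 2).
{ intros t. rewrite En. unfold g, dot, affine_pt. simpl. ring. }
assert (HD : forall t, edist P (affine_pt Q S t) ^ 2 =
  (1 - t) ^ 2 * m ^ 2 + 2 * t * (1 - t) * g + t ^ 2 * n ^ 2).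
{ intros t. rewrite edist_sqr, Em, En. unfold g, dot, affine_pt. simpl. ring. }
assert (HDpos : forall t, 0 < edist P (affine_pt Q S t)).
{ intros t. apply edist_pos. unfold affine_pt. simpl.
  destruct (Req_dec (fst P) (fst Q + t * (fst S - fst Q))) as [H1|H1]; [right | now left].
  intros H2. apply Hc. unfold cross. rewrite H1, H2. ring. }
split.
- intros (D & (t & Ht & ->) & Ha & <-).
  pose proof (cos_angle Q P (affine_pt Q S t) Hm (HDpos t)) as C1.
  pose proof (cos_angle (affine_pt Q S t) P S (HDpos t) Hn) as C2.
  rewrite <- Ha in C2. rewrite HQ in C1. rewrite HS in C2.
  specialize (HD t). specialize (HDpos t).
  fold m in C1. fold n in C2.
  set (e := edist P (affine_pt Q S t)) in *.
  (* Equality of the two cosines at P factors; by [Hmn] only the factor that fixes the ratio can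
     vanish. *)
  assert (E : (m * n - g) * ((1 - t) * m - t * n) = 0).
  { assert (E' : n * ((1 - t) * m ^ 2 + t * g) = m * ((1 - t) * g + t * n ^ 2)).
    { rewrite <- C1, <- C2. ring. } lra. }
  apply Rmult_integral in E. destruct E as [E|E]; [exfalso; lra |].
  assert (Et : t = m / (m + n)) by (apply (Rmult_eq_reg_r (m + n)); [transitivity m; [ lra | field; lra] | lra]).
  rewrite HD, Et. field. lra.
- intros H. exists (affine_pt Q S (m / (m + n))). split; [| split].
  + exists (m / (m + n)). split; [| reflexivity]. split.
    * apply Rle_mult_inv_pos; lra.
    * apply (Rmult_le_reg_r (m + n)); [lra |].
      replace (m / (m + n) * (m + n)) with m by (field; lra). lra.
  + apply angle_eq. rewrite HQ, HS. fold m n.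
    specialize (HDpos (m / (m + n))). field. lra.
  + apply sqr_eq_nonneg; [apply edist_nonneg | exact Hl |].
    rewrite HD. apply (Rmult_eq_reg_r ((m + n) ^ 2)); [rewrite H; field; lra |].
    apply pow_nonzero. lra.
Qed.

(** Height times base is twice the area; [cross] is that quantity with a sign, hence the squares. *)
Lemma height_length_cross (P Q S : point) (h : R) :
  cross P Q S <> 0 -> 0 <= h ->
  height_length P Q S h <-> h ^ 2 * edist Q S ^ 2 = cross P Q S ^ 2.
Proof.
intros Hc Hh.
assert (Ha : 0 < edist Q S).
{ apply (edist_pos_cross _ _ P). now rewrite cross_cycle. }
split.
- intros (H & (t & ->) & H1 & H2 & <-).
  (* This difference is the inner product of HP and QS, with H the foot. Adding its square turns the
     goal into the Lagrange identity for these two vectors. *)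
  assert (H3 : dot (affine_pt Q S t) P S - dot (affine_pt Q S t) P Q = 0) by lra.
  replace (cross P Q S ^ 2) with
    (cross P Q S ^ 2 + (dot (affine_pt Q S t) P S - dot (affine_pt Q S t) P Q) ^ 2)
    by (rewrite H3; ring).
  rewrite !edist_sqr. unfold cross, dot, affine_pt. simpl. ring.
- intros H. pose (t := dot Q P S / edist Q S ^ 2). exists (affine_pt Q S t).
  assert (Et : t * edist Q S ^ 2 = dot Q P S) by (unfold t; field; lra).
  assert (H0 : (fst P - (fst Q + t * (fst S - fst Q))) * (fst S - fst Q)
             + (snd P - (snd Q + t * (snd S - snd Q))) * (snd S - snd Q) = 0).
  { rewrite edist_sqr in Et. unfold dot in Et. lra. }
  split; [now exists t | split; [| split]].
  + unfold dot, affine_pt. simpl.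
    transitivity (- t * ((fst P - (fst Q + t * (fst S - fst Q))) * (fst S - fst Q)
             + (snd P - (snd Q + t * (snd S - snd Q))) * (snd S - snd Q)));
      [ring | rewrite H0; ring].
  + unfold dot, affine_pt. simpl.
    transitivity ((1 - t) * ((fst P - (fst Q + t * (fst S - fst Q))) * (fst S - fst Q)
             + (snd P - (snd Q + t * (snd S - snd Q))) * (snd S - snd Q)));
      [ring | rewrite H0; ring].
  + apply sqr_eq_nonneg; [apply edist_nonneg | exact Hh |].
    apply (Rmult_eq_reg_r (edist Q S ^ 2)); [| apply pow_nonzero; lra].
    rewrite H.
    transitivity (cross P Q S ^ 2 +
      ((fst P - (fst Q + t * (fst S - fst Q))) * (fst S - fst Q)
             + (snd P - (snd Q + t * (snd S - snd Q))) * (snd S - snd Q)) ^ 2);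
      [| rewrite H0; ring].
    rewrite !edist_sqr. unfold cross, affine_pt. simpl. ring.
Qed.

(** * Congruence by three sides *)

(** Equal sides force equal inner products at A and, by the Lagrange identity, equal squared areas.
    The sign [s] records whether the orientations agree, and with it the isometry can be written
    down explicitly. *)
Lemma congruent_sides (T U : Defs.triangle) :
  congruent T U <->
  edist (vB T) (vC T) = edist (vB U) (vC U) /\
  edist (vC T) (vA T) = edist (vC U) (vA U) /\
  edist (vA T) (vB T) = edist (vA U) (vB U).
Proof.
split.
- intros (f & Hf & <- & <- & <-). now rewrite !Hf.
- destruct T as [A B C HT], U as [A' B' C' HU]. simpl. intros (Ha & Hb & Hc).
  pose proof (fun E => HT (proj2 (collinear_cross A B C) E)) as HX.
  pose proof (edist_pos_cross _ _ _ HX) as Hpos.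
  assert (Ec2 : edist A B ^ 2 = edist A' B' ^ 2) by now rewrite Hc.
  assert (Ed : dot A B C = dot A' B' C').
  { pose proof (dot_sides A B C) as D1. pose proof (dot_sides A' B' C') as D2.
    rewrite (edist_sym A C), Ha, Hb, Hc in D1. rewrite (edist_sym A' C') in D2. lra. }
  assert (Ex : cross A B C ^ 2 = cross A' B' C' ^ 2).
  { pose proof (lagrange_identity A B C) as L1. pose proof (lagrange_identity A' B' C') as L2.
    rewrite (edist_sym A C), Hb, Hc, Ed in L1. rewrite (edist_sym A' C') in L2. lra. }
  assert (Hs : exists s, s ^ 2 = 1 /\ cross A' B' C' = s * cross A B C).
  { assert (E : (cross A' B' C' - cross A B C) * (cross A' B' C' + cross A B C) = 0) by lra.
    apply Rmult_integral in E. destruct E; [exists 1 | exists (-1)]; split; lra. }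
  destruct Hs as (s & Hs & Es).
  assert (Ec : edist A B ^ 2 <> 0) by (apply pow_nonzero; lra).
  set (q := edist A B ^ 2) in *.
  (* In complex notation, f X = A' + (B' - A') (X - A) / (B - A), with the last
     quotient conjugated if the two triangles have opposite orientations. *)
  pose (f := fun X : point =>
    (fst A' + (dot A B X * (fst B' - fst A') - s * cross A B X * (snd B' - snd A')) / q,
     snd A' + (dot A B X * (snd B' - snd A') + s * cross A B X * (fst B' - fst A')) / q)).
  exists f. cbn [vA vB vC]. split; [| split; [| split]].
  + intros X Y. apply edist_eq; [apply edist_nonneg |]. unfold f. cbn [fst snd].
    assert (E : (dot A B X - dot A B Y) ^ 2 + (cross A B X - cross A B Y) ^ 2
      = q * edist X Y ^ 2).
    { unfold q. rewrite !edist_sqr. unfold dot, cross. ring. }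
    assert (E' : edist X Y ^ 2 =
      ((dot A B X - dot A B Y) ^ 2 + s ^ 2 * (cross A B X - cross A B Y) ^ 2)
        * edist A' B' ^ 2 / q ^ 2).
    { rewrite Hs, <- Ec2. replace (_ ^ 2 + 1 * _) with (q * edist X Y ^ 2) by lra.
      field. exact Ec. }
    rewrite E', edist_sqr. field. exact Ec.
  + unfold f. destruct A' as [a1 a2]. unfold dot, cross. simpl. f_equal; field; exact Ec.
  + unfold f.
    assert (D1 : dot A B B = q) by (unfold q; rewrite edist_sqr; unfold dot; ring).
    assert (D2 : cross A B B = 0) by (unfold cross; ring).
    rewrite D1, D2. destruct B' as [b1 b2]. simpl. f_equal; field; exact Ec.
  (* After the rewriting only A', B', C' occur: the formula recovers C' from its components along
     and across A'B'. *)
  + unfold f. rewrite <- Es, Ed, Ec2.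
    assert (Ec' : edist A' B' ^ 2 <> 0) by now rewrite <- Ec2.
    rewrite edist_sqr in Ec'. rewrite edist_sqr. unfold dot, cross.
    destruct A' as [a1 a2], B' as [b1 b2], C' as [c1 c2]. simpl in *.
    f_equal; field; lra.
Qed.

(** * Parametrisation of triangles by circumdiameter and angles *)

(* The triangle has half-sum [w] and half-difference [d] of its angles at B and
   C, and circumdiameter [k]. *)
Definition sine_law (T : Defs.triangle) (k w d : R) : Prop :=
  0 < k /\ - w < d < w /\ w < PI / 2 /\
  edist (vB T) (vC T) = k * sin (2 * w) /\
  edist (vC T) (vA T) = k * sin (w + d) /\
  edist (vA T) (vB T) = k * sin (w - d).

Lemma sin2_cos2_pow (t : R) : sin t ^ 2 = 1 - cos t ^ 2.
Proof. pose proof (sin2_cos2 t) as H. unfold Rsqr in H. lra. Qed.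

Lemma sin_acos_pos (r : R) : r ^ 2 < 1 ->
  0 < acos r < PI /\ cos (acos r) = r /\ 0 < sin (acos r).
Proof.
intros Hr. assert (H1 : -1 < r < 1) by nra.
assert (H2 : cos (acos r) = r) by (apply cos_acos; lra).
pose proof (acos_bound_lt r H1) as H3.
repeat split; try apply H3; [exact H2 | apply sin_gt_0; apply H3].
Qed.

Lemma sine_law_exists (T : Defs.triangle) : exists k w d, sine_law T k w d.
Proof.
destruct T as [A B C HT]. unfold sine_law. cbn [vA vB vC].
pose proof (fun E => HT (proj2 (collinear_cross A B C) E)) as HX.
assert (Hc : 0 < edist A B) by now apply (edist_pos_cross _ _ C).
assert (Ha : 0 < edist B C) by (apply (edist_pos_cross _ _ A); now rewrite cross_cycle).
assert (Hb : 0 < edist C A) by (apply (edist_pos_cross _ _ B); now rewrite cross_cycle, cross_cycle).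
pose proof (lagrange_identity A B C) as L.
pose proof (dot_sides A B C) as D. rewrite (edist_sym A C) in *.
set (a := edist B C) in *. set (b := edist C A) in *. set (c := edist A B) in *.
(* [K] is twice the area and [EK] is Heron's formula. From here on only the sides and [K] matter, so
   the coordinates are dropped. *)
set (K := Rabs (cross A B C)).
assert (HK : 0 < K) by now apply Rabs_pos_lt.
assert (EK : 4 * K ^ 2 = 4 * b ^ 2 * c ^ 2 - (c ^ 2 + b ^ 2 - a ^ 2) ^ 2).
{ unfold K. rewrite <- D, pow2_abs. lra. }
clearbody K a b c. clear L D.
(* The angle at an end of the side a, with p the other adjacent side and q the opposite one: the law
   of cosines gives its cosine, the area its sine. *)
assert (Angle : forall p q : R, 0 < p -> 0 < q ->
  4 * K ^ 2 = 4 * a ^ 2 * p ^ 2 - (a ^ 2 + p ^ 2 - q ^ 2) ^ 2 ->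
  exists t, 0 < t < PI /\ a * p * sin t = K /\ 2 * a * p * cos t = a ^ 2 + p ^ 2 - q ^ 2).
{ intros p q Hp Hq E. set (r := (a ^ 2 + p ^ 2 - q ^ 2) / (2 * a * p)).
  assert (Hap : 0 < a * p) by now apply Rmult_lt_0_compat.
  assert (Er : 2 * a * p * r = a ^ 2 + p ^ 2 - q ^ 2) by (unfold r; field; lra).
  rewrite <- Er in *.
  assert (Hr : r ^ 2 < 1).
  { apply (Rmult_lt_reg_r (4 * (a * p) ^ 2)); [nra |].
    pose proof (pow_lt K 2 HK). lra. }
  destruct (sin_acos_pos r Hr) as (Ht & Ec & Hs).
  exists (acos r). split; [exact Ht |]. rewrite Ec. split; [| reflexivity].
  apply sqr_eq_nonneg; [nra | lra |].
  rewrite Rpow_mult_distr, sin2_cos2_pow, Ec. lra. }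
destruct (Angle c b Hc Hb ltac:(lra)) as (tB & HB & SB & CB).
destruct (Angle b c Hb Hc ltac:(lra)) as (tC & HC & SC & CC).
assert (sB : 0 < sin tB) by (apply sin_gt_0; lra).
assert (sC : 0 < sin tC) by (apply sin_gt_0; lra).
assert (Eb : b / sin tB * sin tC = c).
{ apply (Rmult_eq_reg_l (a * sin tB)); [| nra].
  transitivity (a * b * sin tC); [field; lra | lra]. }
(* The projection formula a = b cos C + c cos B, divided by the circumdiameter, is the addition
   formula for sin (B + C). *)
assert (Esin : b / sin tB * sin (tB + tC) = a).
{ rewrite sin_plus. transitivity (b * cos tC + b / sin tB * sin tC * cos tB); [field; lra |].
  rewrite Eb. apply (Rmult_eq_reg_l (2 * a)); lra. }
assert (Hk : 0 < b / sin tB) by now apply Rdiv_lt_0_compat.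
(* Otherwise sin (B + C) would not be positive, although a is. *)
assert (Hsum : tB + tC < PI).
{ destruct (Rlt_or_le (tB + tC) PI) as [|H]; [assumption | exfalso].
  assert (sin (tB + tC) <= 0) by (apply sin_le_0; lra). nra. }
exists (b / sin tB), ((tB + tC) / 2), ((tB - tC) / 2).
replace (2 * ((tB + tC) / 2)) with (tB + tC) by field.
replace ((tB + tC) / 2 + (tB - tC) / 2) with tB by field.
replace ((tB + tC) / 2 - (tB - tC) / 2) with tC by field.
repeat split; try lra. field; lra.
Qed.

Lemma sine_law_triangle (k w d : R) : 0 < k -> - w < d < w -> w < PI / 2 ->
  exists T, sine_law T k w d.
Proof.
intros Hk Hd Hw.
assert (sB : 0 < sin (w + d)) by (apply sin_gt_0; lra).
assert (sC : 0 < sin (w - d)) by (apply sin_gt_0; lra).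
assert (sA : 0 < sin (2 * w)) by (apply sin_gt_0; lra).
assert (E2 : sin (2 * w) = sin (w + d) * cos (w - d) + cos (w + d) * sin (w - d)).
{ rewrite <- sin_plus. f_equal. ring. }
(* BC lies on the first axis and the foot of the altitude from A is the origin; k sin B sin C is the
   height. *)
pose (A := (0, k * sin (w + d) * sin (w - d)) : point).
pose (B := (- (k * sin (w - d) * cos (w + d)), 0) : point).
pose (C := (k * sin (w + d) * cos (w - d), 0) : point).
assert (HT : ~ collinear A B C).
{ rewrite collinear_cross.
  replace (cross A B C) with (k ^ 2 * sin (w + d) * sin (w - d) * sin (2 * w))
    by (rewrite E2; unfold cross, A, B, C; simpl; ring).
  repeat apply Rmult_integral_contrapositive_currified; lra. }
exists (Triangle A B C HT). unfold sine_law. cbn [vA vB vC].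
repeat split; try lra; (apply edist_eq; [nra |]); unfold A, B, C; cbn [fst snd].
- rewrite E2. ring.
- transitivity (k ^ 2 * sin (w + d) ^ 2 * (cos (w - d) ^ 2 + sin (w - d) ^ 2)); [ring |].
  rewrite (sin2_cos2_pow (w - d)). ring.
- transitivity (k ^ 2 * sin (w - d) ^ 2 * (cos (w + d) ^ 2 + sin (w + d) ^ 2)); [ring |].
  rewrite (sin2_cos2_pow (w + d)). ring.
Qed.

Lemma sine_law_congruent (T U : Defs.triangle) (k w d : R) :
  sine_law T k w d -> sine_law U k w d -> congruent T U.
Proof.
intros (_ & _ & _ & a1 & b1 & c1) (_ & _ & _ & a2 & b2 & c2).
apply congruent_sides. now rewrite a1, b1, c1, a2, b2, c2.
Qed.

(** The sign of d is that of CA - AB = 2 k cos w sin d, which congruence preserves. *)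
Lemma sine_law_not_congruent (T U : Defs.triangle) (k w d k' w' d' : R) :
  sine_law T k w d -> sine_law U k' w' d' -> d < 0 < d' -> ~ congruent T U.
Proof.
intros (k1 & d1 & w1 & _ & b1 & c1) (k2 & d2 & w2 & _ & b2 & c2) Hd HC.
apply congruent_sides in HC. destruct HC as (_ & Hb & Hc).
rewrite b1, b2 in Hb. rewrite c1, c2 in Hc. rewrite sin_plus in Hb.
rewrite sin_plus in Hb. rewrite !sin_minus in Hc.
assert (E : k * (cos w * sin d) = k' * (cos w' * sin d')) by lra.
assert (0 < cos w) by (apply cos_gt_0; lra).
assert (0 < cos w') by (apply cos_gt_0; lra).
assert (sin d < 0) by (apply sin_lt_0_var; lra).
assert (0 < sin d') by (apply sin_gt_0; lra).
assert (0 < k' * (cos w' * sin d')) by (repeat apply Rmult_lt_0_compat; lra).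
assert (cos w * sin d < 0) by nra. nra.
Qed.

(** * The prescribed lengths in angular coordinates *)

(** The angles at A, B, C are PI - 2 w, w + d and w - d. The last equation is the condition on l_b
    with k eliminated by means of the height, so that for given d and x it involves w alone. *)
Lemma has_data_sine_law (T : Defs.triangle) (k w d l1 l2 x : R) :
  0 < l1 -> 0 < l2 -> sine_law T k w d ->
  has_data l1 l2 x T <->
  x = k * sin (w + d) * sin (w - d) /\ x = l2 * cos d /\
  l1 * sin ((w + d) / 2) * (sin (2 * w) + sin (w - d)) = x * sin (2 * w).
Proof.
intros Hl1 Hl2 (Hk & Hd & Hw & Ea & Eb & Ec).
destruct T as [A B C HT]. unfold has_data, l_a, l_b, h_a. cbn [vA vB vC] in *.
pose proof (fun E => HT (proj2 (collinear_cross A B C) E)) as HX.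
pose proof HX as HX'. rewrite <- (cross_cycle A B C) in HX'.
assert (sB : 0 < sin (w + d)) by (apply sin_gt_0; lra).
assert (sC : 0 < sin (w - d)) by (apply sin_gt_0; lra).
assert (sA : 0 < sin (2 * w)) by (apply sin_gt_0; lra).
assert (sw : 0 < sin w) by (apply sin_gt_0; lra).
assert (cw : 0 < cos w) by (apply cos_gt_0; lra).
assert (cd : 0 < cos d) by (apply cos_gt_0; lra).
assert (sb : 0 < sin ((w + d) / 2)) by (apply sin_gt_0; lra).
assert (cb : 0 < cos ((w + d) / 2)) by (apply cos_gt_0; lra).
assert (hpos : 0 < k * sin (w + d) * sin (w - d)) by (repeat apply Rmult_lt_0_compat; lra).
assert (hsimp : sin (w + d) * sin (w - d) = cos d ^ 2 - cos w ^ 2).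
{ rewrite sin_plus, sin_minus.
  transitivity (sin w ^ 2 * cos d ^ 2 - cos w ^ 2 * sin d ^ 2); [ring |].
  rewrite !sin2_cos2_pow. ring. }
(* The bisector from A makes the angle d with the altitude. Up to the factor 4 k^2 sin^2 w, the
   length formula is the square of this relation. *)
assert (La : bisector_length A B C l2 <-> k * sin (w + d) * sin (w - d) = l2 * cos d).
{ rewrite (bisector_length_sides _ _ _ _ HX) by lra.
  rewrite (edist_sym A C), Ea, Eb, Ec.
  assert (F : 0 < 4 * k ^ 2 * sin w ^ 2) by (repeat apply Rmult_lt_0_compat; try apply pow_lt; lra).
  assert (E1 : (l2 * cos d) ^ 2 * (4 * k ^ 2 * sin w ^ 2)
     = l2 ^ 2 * (k * sin (w - d) + k * sin (w + d)) ^ 2).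
  { rewrite sin_plus, sin_minus. ring. }
  assert (E2 : (k * sin (w + d) * sin (w - d)) ^ 2 * (4 * k ^ 2 * sin w ^ 2) =
    k * sin (w - d) * (k * sin (w + d)) *
      ((k * sin (w - d) + k * sin (w + d)) ^ 2 - (k * sin (2 * w)) ^ 2)).
  { replace (k * sin (w - d) * (k * sin (w + d))) with (k * (k * (sin (w + d) * sin (w - d)))) by ring.
    replace (k * sin (w + d) * sin (w - d)) with (k * (sin (w + d) * sin (w - d))) by ring.
    replace (k * sin (w - d) + k * sin (w + d)) with (2 * k * sin w * cos d)
      by (rewrite sin_plus, sin_minus; ring).
    rewrite hsimp, sin_2a. ring. }
  rewrite <- E1, <- E2. split; intros H.
  - apply sqr_eq_nonneg; [lra | nra |]. symmetry.
    apply (Rmult_eq_reg_r (4 * k ^ 2 * sin w ^ 2)); lra.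
  - now rewrite H. }
assert (Ha : forall h, height_length A B C h <-> h = k * sin (w + d) * sin (w - d)).
{ assert (E : (k * sin (w + d) * sin (w - d)) ^ 2 * edist B C ^ 2 = cross A B C ^ 2).
  { pose proof (lagrange_identity A B C) as L. pose proof (dot_sides A B C) as D.
    rewrite (edist_sym A C), Eb, Ec in *. rewrite Ea in D |- *.
    replace (cross A B C ^ 2) with
      ((k * sin (w - d) * (k * sin (w + d))) ^ 2 - (2 * dot A B C) ^ 2 / 4) by lra.
    rewrite D.
    (* The law of cosines at A, divided by k^2; the sign comes from cos A = - cos (2 w). *)
    assert (cosA : sin (w - d) ^ 2 + sin (w + d) ^ 2 - sin (2 * w) ^ 2
      = - 2 * sin (w - d) * sin (w + d) * cos (2 * w)).
    { replace (- 2 * sin (w - d) * sin (w + d)) with (- 2 * (sin (w + d) * sin (w - d))) by ring.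
      rewrite hsimp. rewrite sin_2a, cos_2a_cos, sin_plus, sin_minus.
      transitivity (2 * (sin w ^ 2 * cos d ^ 2 + cos w ^ 2 * sin d ^ 2)
         - 4 * sin w ^ 2 * cos w ^ 2); [ring |].
      rewrite !sin2_cos2_pow. ring. }
    replace ((k * sin (w - d)) ^ 2 + (k * sin (w + d)) ^ 2 - (k * sin (2 * w)) ^ 2)
      with (k ^ 2 * (- 2 * sin (w - d) * sin (w + d) * cos (2 * w)))
      by (rewrite <- cosA; ring).
    transitivity (k ^ 4 * sin (w + d) ^ 2 * sin (w - d) ^ 2 * sin (2 * w) ^ 2); [ring |].
    rewrite (sin2_cos2_pow (2 * w)). field. }
  assert (Epos : 0 < edist B C) by (rewrite Ea; now apply Rmult_lt_0_compat).
  intros h. split; intros H.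
  - assert (Hh : 0 <= h) by (destruct H as (? & _ & _ & _ & <-); apply edist_nonneg).
    apply (height_length_cross _ _ _ _ HX Hh) in H. rewrite <- E in H.
    apply sqr_eq_nonneg; [exact Hh | lra |].
    apply (Rmult_eq_reg_r (edist B C ^ 2)); [exact H | apply pow_nonzero; lra].
  - rewrite H. apply height_length_cross; [exact HX | lra | exact E]. }
assert (Lb : bisector_length B C A l1 <->
  l1 * (sin (2 * w) + sin (w - d)) = 2 * k * sin (2 * w) * sin (w - d) * cos ((w + d) / 2)).
{ rewrite (bisector_length_sides _ _ _ _ HX') by lra.
  rewrite (edist_sym B A), Ea, Eb, Ec.
  (* The law of cosines at B in the form (a + c)^2 - b^2 = 4 a c cos^2 (B / 2), divided by k^2. *)
  assert (cosB : (sin (2 * w) + sin (w - d)) ^ 2 - sin (w + d) ^ 2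
    = 4 * sin (2 * w) * sin (w - d) * cos ((w + d) / 2) ^ 2).
  { replace (2 * w) with ((w + d) + (w - d)) by ring.
    assert (C2 : cos (w + d) = 2 * cos ((w + d) / 2) ^ 2 - 1).
    { replace (w + d) with (2 * ((w + d) / 2)) at 1 by field. rewrite cos_2a_cos. ring. }
    replace (cos ((w + d) / 2) ^ 2) with ((1 + cos (w + d)) / 2) by lra.
    rewrite sin_plus. set (p := w + d) in *. set (q := w - d) in *.
    transitivity (sin p ^ 2 * (cos q ^ 2 - 1) + sin q ^ 2 * cos p ^ 2 + sin q ^ 2
      + 2 * (sin p * cos q + cos p * sin q) * sin q * (1 + cos p)
      - 2 * cos p ^ 2 * sin q ^ 2 ); [ring |].
    rewrite (sin2_cos2_pow p).
    transitivity (2 * (sin p * cos q + cos p * sin q) * sin q * (1 + cos p)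
      + (1 - cos p ^ 2) * (sin q ^ 2 + cos q ^ 2 - 1)); [ring |].
    rewrite (sin2_cos2_pow q). field. }
  assert (E2 : k * sin (2 * w) * (k * sin (w - d)) *
    ((k * sin (2 * w) + k * sin (w - d)) ^ 2 - (k * sin (w + d)) ^ 2)
    = k ^ 2 * (2 * k * sin (2 * w) * sin (w - d) * cos ((w + d) / 2)) ^ 2).
  { transitivity (k ^ 4 * sin (2 * w) * sin (w - d) *
      ((sin (2 * w) + sin (w - d)) ^ 2 - sin (w + d) ^ 2)); [ring |].
    rewrite cosB. ring. }
  rewrite E2.
  replace (l1 ^ 2 * (k * sin (2 * w) + k * sin (w - d)) ^ 2)
    with (k ^ 2 * (l1 * (sin (2 * w) + sin (w - d))) ^ 2) by ring.
  split; intros H.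
  - apply sqr_eq_nonneg; [nra | repeat apply Rmult_le_pos; lra |].
    apply (Rmult_eq_reg_l (k ^ 2)); [exact H | apply pow_nonzero; lra].
  - now rewrite H. }
rewrite La, Lb, Ha.
(* Multiplying the condition on l_b by sin (B / 2) produces sin B, hence the height k sin B sin C on
   the right. *)
assert (S2 : sin (w + d) = 2 * sin ((w + d) / 2) * cos ((w + d) / 2)).
{ replace (w + d) with (2 * ((w + d) / 2)) at 1 by field. apply sin_2a. }
split.
- intros (H1 & H2 & H3). split; [exact H3 | split; [lra |]].
  transitivity (sin ((w + d) / 2) * (l1 * (sin (2 * w) + sin (w - d)))); [ring |].
  rewrite H2, H3. rewrite S2. ring.
- intros (H1 & H2 & H3). split; [lra | split; [| exact H1]].
  apply (Rmult_eq_reg_l (sin ((w + d) / 2))); [| lra].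
  transitivity (x * sin (2 * w)); [lra |]. rewrite H1, S2. ring.
Qed.

(** * The equation for w at fixed d *)

(* Multiplied by [2 cos ((w + d) / 2)], the equation compares a factor that
   decreases in [w] with [(sin w ^ 2 - sin d ^ 2) / (sin w * cos w)], which increases. *)
Lemma bisector_equation_factored (l1 x d w : R) : - w < d < w -> w < PI / 2 -> 0 < l1 ->
  l1 * sin ((w + d) / 2) * (sin (2 * w) + sin (w - d)) = x * sin (2 * w) ->
  4 * (cos ((w + d) / 2) * (x - l1 * sin ((w + d) / 2))) * sin w * cos w =
    l1 * (sin w ^ 2 - sin d ^ 2) /\
  l1 * sin ((w + d) / 2) < x.
Proof.
intros Hd Hw Hl E. split.
- transitivity (2 * cos ((w + d) / 2) *
    (x * sin (2 * w) - l1 * sin ((w + d) / 2) * sin (2 * w))).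
  { rewrite (sin_2a w). ring. }
  rewrite <- E.
  transitivity (l1 * sin (2 * ((w + d) / 2)) * sin (w - d)); [rewrite (sin_2a ((w + d) / 2)); ring |].
  replace (2 * ((w + d) / 2)) with (w + d) by field. rewrite sin_plus, sin_minus.
  transitivity (l1 * (sin w ^ 2 * cos d ^ 2 - cos w ^ 2 * sin d ^ 2)); [ring |].
  rewrite !sin2_cos2_pow. ring.
(* The term with sin (w - d) is positive; dropping it and cancelling sin (2 w) leaves the bound. *)
- assert (0 < sin (2 * w)) by (apply sin_gt_0; lra).
  assert (0 < sin (w - d)) by (apply sin_gt_0; lra).
  assert (0 < sin ((w + d) / 2)) by (apply sin_gt_0; lra).
  assert (0 < l1 * sin ((w + d) / 2) * sin (w - d)) by (repeat apply Rmult_lt_0_compat; lra).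
  apply (Rmult_lt_reg_r (sin (2 * w))); lra.
Qed.

Lemma bisector_equation_not_lt (l1 x d w w' : R) : 0 < l1 ->
  - w < d < w -> w < w' -> w' < PI / 2 ->
  l1 * sin ((w + d) / 2) * (sin (2 * w) + sin (w - d)) = x * sin (2 * w) ->
  l1 * sin ((w' + d) / 2) * (sin (2 * w') + sin (w' - d)) <> x * sin (2 * w').
Proof.
intros Hl Hd Hlt Hw E E'.
apply bisector_equation_factored in E, E'; try lra.
destruct E as [E P], E' as [E' P'].
assert (S : 0 < sin w) by (apply sin_gt_0; lra).
assert (SS : sin w < sin w') by (apply sin_increasing_1; lra).
assert (K : 0 < cos w') by (apply cos_gt_0; lra).
assert (KK : cos w' < cos w) by (apply cos_decreasing_1; lra).
assert (k : 0 < cos ((w' + d) / 2)) by (apply cos_gt_0; lra).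
assert (kk : cos ((w' + d) / 2) < cos ((w + d) / 2)) by (apply cos_decreasing_1; lra).
assert (ss : sin ((w + d) / 2) < sin ((w' + d) / 2)) by (apply sin_increasing_1; lra).
apply (Rmult_lt_compat_l l1) in ss; [| exact Hl].
(* Both factors are positive, by [P] and [P'] for the second, and both decrease. *)
assert (F : cos ((w' + d) / 2) * (x - l1 * sin ((w' + d) / 2)) <
  cos ((w + d) / 2) * (x - l1 * sin ((w + d) / 2))) by (apply Rmult_gt_0_lt_compat; lra).
assert (F0 : 0 < cos ((w' + d) / 2) * (x - l1 * sin ((w' + d) / 2)))
  by (apply Rmult_lt_0_compat; lra).
set (f' := cos ((w' + d) / 2) * _) in *. set (f := cos ((w + d) / 2) * _) in *.
assert (G : f' * cos w' < f * cos w) by (apply Rmult_gt_0_lt_compat; lra).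
(* Scaling by sin w sin w' lets both equations be substituted without division. *)
assert (G1 : 4 * (f' * cos w') * (sin w * sin w') < 4 * (f * cos w) * (sin w * sin w')).
{ apply Rmult_lt_compat_r; [apply Rmult_lt_0_compat |]; lra. }
replace (4 * (f' * cos w') * (sin w * sin w'))
  with (l1 * (sin w' ^ 2 - sin d ^ 2) * sin w) in G1 by (rewrite <- E'; ring).
replace (4 * (f * cos w) * (sin w * sin w'))
  with (l1 * (sin w ^ 2 - sin d ^ 2) * sin w') in G1 by (rewrite <- E; ring).
(* This product is the left side of [G1] minus its right side, so it contradicts [G1]. *)
assert (0 < l1 * ((sin w' - sin w) * (sin w * sin w' + sin d ^ 2))).
{ apply Rmult_lt_0_compat; [lra | apply Rmult_lt_0_compat; [lra |]].
  apply Rplus_lt_le_0_compat; [apply Rmult_lt_0_compat; lra | apply pow2_ge_0]. }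
lra.
Qed.

Lemma bisector_equation_unique (l1 x d w w' : R) : 0 < l1 ->
  - w < d < w -> w < PI / 2 -> - w' < d < w' -> w' < PI / 2 ->
  l1 * sin ((w + d) / 2) * (sin (2 * w) + sin (w - d)) = x * sin (2 * w) ->
  l1 * sin ((w' + d) / 2) * (sin (2 * w') + sin (w' - d)) = x * sin (2 * w') ->
  w = w'.
Proof.
intros Hl Hd Hw Hd' Hw' E E'.
destruct (Rtotal_order w w') as [H | [H | H]]; [exfalso | exact H | exfalso].
- now apply (bisector_equation_not_lt l1 x d w w').
- now apply (bisector_equation_not_lt l1 x d w' w).
Qed.

Lemma continuous_root (f : R -> R) (a b : R) :
  continuity f -> a < b -> 0 < f a -> f b < 0 -> exists w, a < w < b /\ f w = 0.
Proof.
intros Hf Hab Ha Hb.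
destruct (IVT (fun t => - f t) a b) as (w & Hw & E); [| exact Hab | lra | lra |].
- now apply continuity_opp.
- assert (E0 : f w = 0) by lra. exists w. split; [| exact E0].
  split.
  + destruct (Req_dec a w) as [<- | ]; lra.
  + destruct (Req_dec w b) as [-> | ]; lra.
Qed.

(** Intermediate values on [|d|, PI / 2]. At PI / 2 only a negative term survives. At w = |d| the
    difference is x sin (2 |d|) for d < 0 and (x - l1 sin d) sin (2 d) for d > 0, positive in both
    cases. *)
Lemma bisector_equation_solvable (l1 x d : R) :
  0 < l1 -> 0 < x -> - (PI / 2) < d < PI / 2 -> l1 * sin d < x ->
  exists w, - w < d < w /\ w < PI / 2 /\
  l1 * sin ((w + d) / 2) * (sin (2 * w) + sin (w - d)) = x * sin (2 * w).
Proof.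
intros Hl Hx Hd Hs. pose proof PI_RGT_0 as Hpi.
pose (f := fun w => x * sin (2 * w) - l1 * sin ((w + d) / 2) * (sin (2 * w) + sin (w - d))).
assert (Hf : continuity f).
{ unfold f. intros t. apply derivable_continuous_pt. reg. }
assert (Hend : f (PI / 2) < 0).
{ unfold f. replace (2 * (PI / 2)) with PI by field. rewrite sin_PI.
  rewrite sin_minus, sin_PI2, cos_PI2.
  assert (0 < cos d) by (apply cos_gt_0; lra).
  assert (0 < sin ((PI / 2 + d) / 2)) by (apply sin_gt_0; lra).
  assert (0 < l1 * sin ((PI / 2 + d) / 2) * cos d) by (repeat apply Rmult_lt_0_compat; lra).
  lra. }
destruct (Rtotal_order d 0) as [H | [-> | H]].
- destruct (continuous_root f (- d) (PI / 2) Hf) as (w & Hw & E); [lra | | exact Hend |].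
  + unfold f. replace ((- d + d) / 2) with 0 by field. rewrite sin_0.
    assert (0 < x * sin (2 * - d)) by (apply Rmult_lt_0_compat; [lra | apply sin_gt_0; lra]).
    lra.
  + exists w. unfold f in E. repeat split; lra.
- (* At [w = d = 0] the equation degenerates; its factor [sin w] is removed first. *)
  pose (g := fun w => 2 * x * cos w - l1 * sin ((w + 0) / 2) * (2 * cos w + 1)).
  destruct (continuous_root g 0 (PI / 2)) as (w & Hw & E).
  + unfold g. intros t. apply derivable_continuous_pt. reg.
  + lra.
  + unfold g. replace ((0 + 0) / 2) with 0 by field. rewrite sin_0, cos_0. lra.
  + unfold g. rewrite cos_PI2.
    assert (0 < sin ((PI / 2 + 0) / 2)) by (apply sin_gt_0; lra). nra.
  + exists w. repeat split; try lra. unfold g in E.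
    rewrite sin_2a, Rminus_0_r.
    transitivity (sin w * (l1 * sin ((w + 0) / 2) * (2 * cos w + 1))); [ring |].
    replace (l1 * sin ((w + 0) / 2) * (2 * cos w + 1)) with (2 * x * cos w) by lra. ring.
- destruct (continuous_root f d (PI / 2) Hf) as (w & Hw & E); [lra | | exact Hend |].
  + unfold f. replace ((d + d) / 2) with d by field.
    replace (d - d) with 0 by ring. rewrite sin_0.
    assert (0 < (x - l1 * sin d) * sin (2 * d))
      by (apply Rmult_lt_0_compat; [lra | apply sin_gt_0; lra]).
    lra.
  + exists w. unfold f in E. repeat split; lra.
Qed.

(** * Existence and uniqueness for a given d *)

Lemma has_data_exists (l1 l2 x d : R) : 0 < l1 -> 0 < l2 -> 0 < x ->
  - (PI / 2) < d < PI / 2 -> x = l2 * cos d -> l1 * sin d < x ->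
  exists T k w, sine_law T k w d /\ has_data l1 l2 x T.
Proof.
intros Hl1 Hl2 Hx Hd Hc Hs.
destruct (bisector_equation_solvable l1 x d Hl1 Hx Hd Hs) as (w & Hw & Hw' & E).
assert (sB : 0 < sin (w + d)) by (apply sin_gt_0; lra).
assert (sC : 0 < sin (w - d)) by (apply sin_gt_0; lra).
(* The height is k sin B sin C, so this circumdiameter makes it x. *)
set (k := x / (sin (w + d) * sin (w - d))).
assert (Hk : 0 < k) by (apply Rdiv_lt_0_compat; [| apply Rmult_lt_0_compat]; lra).
destruct (sine_law_triangle k w d Hk Hw Hw') as (T & HT).
exists T, k, w. split; [exact HT |].
apply (has_data_sine_law T k w d l1 l2 x Hl1 Hl2 HT).
split; [unfold k; field; lra | now split].
Qed.

Lemma has_data_necessary (T : Defs.triangle) (k w d l1 l2 x : R) :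
  0 < l1 -> 0 < l2 -> sine_law T k w d -> has_data l1 l2 x T ->
  0 < x /\ - (PI / 2) < d < PI / 2 /\ x = l2 * cos d /\ l1 * sin d < x.
Proof.
intros Hl1 Hl2 HT H. apply (has_data_sine_law T k w d l1 l2 x Hl1 Hl2 HT) in H.
destruct H as (H1 & H2 & H3), HT as (Hk & Hd & Hw & _).
assert (sB : 0 < sin (w + d)) by (apply sin_gt_0; lra).
assert (sC : 0 < sin (w - d)) by (apply sin_gt_0; lra).
split; [rewrite H1; repeat apply Rmult_lt_0_compat; lra |].
split; [lra | split; [exact H2 |]].
apply bisector_equation_factored in H3; try lra. destruct H3 as [_ H3].
(* Since d < w, the angle (w + d) / 2 exceeds d, and so does its sine. *)
apply Rlt_trans with (2 := H3). apply Rmult_lt_compat_l; [exact Hl1 |].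
apply sin_increasing_1; lra.
Qed.

(** For given d the equation fixes w, and then the height fixes k. *)
Lemma has_data_unique (T U : Defs.triangle) (k w k' w' d l1 l2 x : R) :
  0 < l1 -> 0 < l2 -> sine_law T k w d -> sine_law U k' w' d ->
  has_data l1 l2 x T -> has_data l1 l2 x U -> congruent T U.
Proof.
intros Hl1 Hl2 HT HU DT DU.
apply (has_data_sine_law T k w d l1 l2 x Hl1 Hl2 HT) in DT.
apply (has_data_sine_law U k' w' d l1 l2 x Hl1 Hl2 HU) in DU.
destruct DT as (T1 & _ & T3), DU as (U1 & _ & U3).
pose proof HT as (_ & Hd & Hw & _). pose proof HU as (_ & Hd' & Hw' & _).
assert (E : w = w') by now apply (bisector_equation_unique l1 x d).
subst w'.
assert (sB : 0 < sin (w + d)) by (apply sin_gt_0; lra).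
assert (sC : 0 < sin (w - d)) by (apply sin_gt_0; lra).
assert (E : k = k').
{ apply (Rmult_eq_reg_r (sin (w + d) * sin (w - d))); [lra |].
  assert (0 < sin (w + d) * sin (w - d)) by now apply Rmult_lt_0_compat. lra. }
subst k'. now apply (sine_law_congruent T U k w d).
Qed.

(** * The threshold and the count of triangles *)

Lemma h_a_starstar_lt (l1 l2 x d : R) : 0 < l1 -> 0 < l2 -> 0 < x ->
  0 <= sin d -> x = l2 * cos d ->
  l1 * sin d < x <-> h_a_starstar l1 l2 < x.
Proof.
intros Hl1 Hl2 Hx Hs Hc. unfold h_a_starstar.
assert (Hq : 0 < l1 ^ 2 + l2 ^ 2) by (pose proof (pow_lt l1 2 Hl1); pose proof (pow_lt l2 2 Hl2); lra).
pose proof (sqrt_lt_R0 _ Hq) as Hr.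
pose proof (pow2_sqrt (l1 ^ 2 + l2 ^ 2) (Rlt_le _ _ Hq)) as Er.
set (r := sqrt (l1 ^ 2 + l2 ^ 2)) in *.
(* Eliminating sin^2 d by l2^2 sin^2 d = l2^2 - x^2 shows that the squared forms of the two
   inequalities differ by a positive factor. *)
assert (E : l2 ^ 2 * (x ^ 2 - (l1 * sin d) ^ 2) = (x * r) ^ 2 - (l1 * l2) ^ 2).
{ rewrite !Rpow_mult_distr, Er, sin2_cos2_pow, Hc. ring. }
assert (P : 0 < l2 ^ 2) by now apply pow_lt.
assert (Q : 0 <= l1 * sin d) by (apply Rmult_le_pos; lra).
assert (P12 : 0 < l1 * l2) by now apply Rmult_lt_0_compat.
assert (Pr : 0 < x * r) by now apply Rmult_lt_0_compat.
transitivity (l1 * l2 < x * r).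
- split; intros H.
  + apply Rsqr_incrst_0; try lra. unfold Rsqr.
    assert (0 < x ^ 2 - (l1 * sin d) ^ 2) by nra. nra.
  + apply Rsqr_incrst_0; try lra. unfold Rsqr.
    assert (0 < (x * r) ^ 2 - (l1 * l2) ^ 2) by nra.
    rewrite <- E in *. apply Rmult_lt_reg_l with (1 := P). lra.
- split; intros H.
  + apply (Rmult_lt_reg_r r); [exact Hr |]. unfold Rdiv.
    rewrite Rmult_assoc, Rinv_l; lra.
  + apply (Rmult_lt_compat_r r) in H; [| exact Hr]. unfold Rdiv in H.
    rewrite Rmult_assoc, Rinv_l in H; lra.
Qed.

Lemma h_a_starstar_bounds (l1 l2 : R) : 0 < l1 -> 0 < l2 ->
  0 < h_a_starstar l1 l2 < l2.
Proof.
intros Hl1 Hl2. split.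
- unfold h_a_starstar. apply Rdiv_lt_0_compat; [now apply Rmult_lt_0_compat |].
  apply sqrt_lt_R0. pose proof (pow_lt l1 2 Hl1). pose proof (pow_lt l2 2 Hl2). lra.
(* The case d = 0 of the comparison, where x = l2. *)
- apply (h_a_starstar_lt l1 l2 l2 0); rewrite ?sin_0, ?cos_0; lra.
Qed.

Lemma cos_eq_acos (d r : R) : - (PI / 2) < d < PI / 2 -> cos d = r ->
  d = acos r \/ d = - acos r.
Proof.
intros Hd <-. destruct (Rle_or_lt 0 d) as [H|H].
- left. rewrite acos_cos; lra.
- right. rewrite <- (cos_neg d), acos_cos; lra.
Qed.

Theorem mainTheorem7 (l1 l2 : R) (hl2 : 0 < l2) (hl : l2 <= l1) (x : R) :
  (h_a_starstar l1 l2 < x < l2 -> exactly_two (has_data l1 l2 x)) /\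
  ((0 < x <= h_a_starstar l1 l2 \/ x = l2) -> exactly_one (has_data l1 l2 x)) /\
  (~ (h_a_starstar l1 l2 < x < l2) ->
   ~ (0 < x <= h_a_starstar l1 l2 \/ x = l2) ->
   none (has_data l1 l2 x)).
Proof.
assert (hl1 : 0 < l1) by lra.
destruct (h_a_starstar_bounds l1 l2 hl1 hl2) as [Hh0 Hh].
pose proof PI_RGT_0 as Hpi.
(* [p] is arccos (x / l2), the value of |d| common to all triangles with the data. *)
assert (Hp : 0 < x <= l2 -> exists p, 0 <= p < PI / 2 /\ x = l2 * cos p /\
  (x < l2 -> 0 < p) /\ 0 <= sin p /\
  forall T, has_data l1 l2 x T -> exists k w d, sine_law T k w d /\ (d = p \/ d = - p)).
{ intros Hx. assert (Hr : 0 < x / l2 <= 1).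
  { split; [now apply Rdiv_lt_0_compat |]. apply (Rmult_le_reg_r l2); [exact hl2 |].
    unfold Rdiv. rewrite Rmult_assoc, Rinv_l; lra. }
  assert (Ep : cos (acos (x / l2)) = x / l2) by (apply cos_acos; lra).
  assert (Hx' : x = l2 * cos (acos (x / l2))) by (rewrite Ep; field; lra).
  pose proof (acos_bound (x / l2)) as Hb.
  assert (Hb' : acos (x / l2) < PI / 2).
  { apply cos_decreasing_0; try lra. rewrite cos_PI2, Ep. lra. }
  exists (acos (x / l2)). split; [lra | split; [exact Hx' | split; [| split]]].
  - intros H. destruct Hb as [[H0 | H0] _]; [exact H0 | exfalso].
    rewrite <- H0, cos_0 in Hx'. lra.
  - apply sin_ge_0; lra.
  - intros T HT. destruct (sine_law_exists T) as (k & w & d & S).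
    exists k, w, d. split; [exact S |].
    destruct (has_data_necessary T k w d l1 l2 x hl1 hl2 S HT) as (_ & Hd & Hc & _).
    apply cos_eq_acos; [exact Hd |]. rewrite Hc. field. lra. }
split; [| split].
- intros Hx. destruct (Hp ltac:(lra)) as (p & Hp0 & Hc & Hpos & Hs & Hall).
  specialize (Hpos ltac:(lra)).
  assert (Hsp : l1 * sin p < x) by (apply (h_a_starstar_lt l1 l2); lra).
  assert (Hsn : 0 <= l1 * sin p) by (apply Rmult_le_pos; lra).
  destruct (has_data_exists l1 l2 x (- p)) as (T1 & k1 & w1 & S1 & D1);
    rewrite ?sin_neg, ?cos_neg; try lra.
  destruct (has_data_exists l1 l2 x p) as (T2 & k2 & w2 & S2 & D2); try lra.
  exists T1, T2. split; [exact D1 | split; [exact D2 | split]].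
  + apply (sine_law_not_congruent T1 T2 k1 w1 (- p) k2 w2 p S1 S2). lra.
  + intros T D. destruct (Hall T D) as (k & w & d & S & [-> | ->]); [right | left].
    * now apply (has_data_unique T T2 k w k2 w2 p l1 l2 x).
    * now apply (has_data_unique T T1 k w k1 w1 (- p) l1 l2 x).
- intros Hx. destruct (Hp ltac:(lra)) as (p & Hp0 & Hc & _ & Hs & Hall).
  assert (Hsn : 0 <= l1 * sin p) by (apply Rmult_le_pos; lra).
  (* The choice - p is always admissible, because l1 sin (- p) <= 0 < x. *)
  destruct (has_data_exists l1 l2 x (- p)) as (T1 & k1 & w1 & S1 & D1);
    rewrite ?sin_neg, ?cos_neg; try lra.
  exists T1. split; [exact D1 |].
  intros T D. destruct (Hall T D) as (k & w & d & S & Hd).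
  (* The choice d = p needs x above the threshold, which here leaves x = l2; then p = 0 and the two
     signs coincide. *)
  assert (E : d = - p).
  { destruct Hd as [-> | ->]; [| reflexivity].
    destruct (has_data_necessary T k w p l1 l2 x hl1 hl2 S D) as (Hx0 & _ & _ & Hlt).
    apply (h_a_starstar_lt l1 l2 x p) in Hlt; try lra.
    assert (Ex : x = l2) by lra.
    assert (cos p = 1) by (apply (Rmult_eq_reg_l l2); lra).
    destruct (Req_dec p 0) as [-> | Hne]; [ring | exfalso].
    assert (cos p < cos 0) by (apply cos_decreasing_1; lra).
    rewrite cos_0 in *. lra. }
  subst d. now apply (has_data_unique T T1 k w k1 w1 (- p) l1 l2 x).
- intros H1 H2 T D. destruct (sine_law_exists T) as (k & w & d & S).
  destruct (has_data_necessary T k w d l1 l2 x hl1 hl2 S D) as (Hx & _ & Hc & _).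
  (* Any triangle with the data has 0 < x <= l2, and the two excluded cases cover this range. *)
  assert (x <= l2) by (rewrite Hc; pose proof (COS_bound d); nra).
  destruct (Rle_or_lt x (h_a_starstar l1 l2)); [apply H2; left; lra |].
  destruct (Req_dec x l2); [apply H2; now right | apply H1; lra].
Qed.
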